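(* Let $C$ be a linear subspace of $L^2_{loc}(G)$ with a seminorm $\|\cdot\|$. Assume that the following properties hold: (a) To each $f\in C$ there is associated a formal expansion $f\sim\sum_{\chi\in\widehat G}c_\chi\chi$ with $c_\chi=c_\chi(f)\in\mathbb{C}$ such that $\|f\|^2=\sum_{\chi\in\widehat{G}}|c_\chi|^2$. (b) $\widehat{G}\subseteq C$, and each $\chi\in\widehat{G}$ has the formal expansion $\chi\sim\chi$. (c) The formal expansion in (a) is linear in $f$. (d) For all $f\in C$, the reflected Eberlein convolution $h_f$ of $f$ with itself exists for every van Hove sequence, is independent of the choice of the van Hove sequence, and is continuous, and the measure $\gamma_f:=h_f\,\theta_G$ satisfies $\widehat{\gamma_f}=\sum_{\chi\in\widehat{G}}|c_\chi(f)|^2\,\delta_\chi$. Then, for every van Hove sequence $\mathcal{A}$, every $f\in C$ is a Weyl $2$-almost periodic function with respect to $\mathcal{A}$, and for each $f\in C$ we have $\|f\|=\|f\|_{\mathsf{W},2,\mathcal{A}}$ and $c_\chi(f)=a_\chi(f)$ for all $\chi\in\widehat{G}$.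
   Context: $G$ is a locally compact (Hausdorff), $\sigma$-compact abelian group with Haar measure $\theta_G$; $|A|=\theta_G(A)$, and $\mathrm{d}t$ denotes integration against $\theta_G$. $\widehat{G}$ is the dual group. A van Hove sequence $\mathcal{A}=(A_n)$ is a sequence of relatively compact open sets (of positive measure) with $|\partial^K A_n|/|A_n|\to 0$ for every compact $K\subseteq G$, where $\partial^K A=\big(\overline{A+K}\cap\overline{A^c}\big)\cup\big(\overline{A^c-K}\cap\overline{A}\big)$. The reflected Eberlein convolution of $f$ with itself with respect to $\mathcal{A}$ is the function $h_f(t)=\lim_{n\to\infty}\frac{1}{|A_n|}\int_{A_n}f(s)\,\overline{f(s-t)}\,\mathrm{d}s$, said to exist if the integrals and the limit exist for all $t\in G$. The Fourier transform $\widehat\gamma$ of a positive definite measure $\gamma$ on $G$ is the unique positive measure on $\widehat G$ with $\int_{\widehat G}|\check\varphi|^2\,\mathrm{d}\widehat\gamma=\int_G(\varphi*\widetilde\varphi)\,\mathrm{d}\gamma$ for all $\varphi\in C_c(G)$, where $\check\varphi(\chi)=\int_G\chi(t)\varphi(t)\,\mathrm{d}t$ and $\widetilde\varphi(s)=\overline{\varphi(-s)}$. For $f\in\mathcal{L}^2_{loc}(G)$ put $\|f\|_{\mathsf{W},2,\mathcal{A}}=\limsup_n\big(\sup_{x\in G}\frac{1}{|A_n|}\int_{x+A_n}|f(t)|^2\,\mathrm{d}t\big)^{1/2}$. A function $f\in\mathcal{L}^2_{loc}(G)$ is Weyl $2$-almost periodic with respect to $\mathcal{A}$ if for each $\varepsilon>0$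 there is a trigonometric polynomial $P$ (finite linear combination of characters) with $\|f-P\|_{\mathsf{W},2,\mathcal{A}}<\varepsilon$. For such $f$ the Fourier--Bohr coefficient $a_\chi(f)=\lim_{n}\frac{1}{|A_n|}\int_{s+A_n}\overline{\chi(t)}f(t)\,\mathrm{d}t$ exists uniformly in $s\in G$. *)

(* Defs.v *)
(* MathComp-Analysis; complex numbers are R[i] over an arbitrary R : realType. *)
From HB Require Import structures.
From mathcomp Require Import all_boot all_order all_algebra.
From mathcomp Require Import all_classical all_reals all_analysis.
From mathcomp Require Import complex.

Set Implicit Arguments.
Unset Strict Implicit.
Unset Printing Implicit Defensive.

Import Order.TTheory GRing.Theory Num.Theory.
Import numFieldNormedType.Exports.

Local Open Scope classical_set_scope.
Local Open Scope ring_scope.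
Local Open Scope complex_scope.

(* R[i] itself has no topology in the library: topological statements about
   complex-valued functions use R[i]^o. *)
Definition normc {R : realType} (z : R[i]) : R := Normc.normc z.

Definition sigma_compact (T : topologicalType) :=
  exists K : (set T)^nat, (forall n, compact (K n)) /\ \bigcup_n K n = setT.

(* A topological group is not canonically a pointed type, but a measurableType
   has to be one; the alias [borel G] of [G] is pointed by the neutral element
   and measurable for the Borel sigma-algebra. *)
Definition borel (G : topologicalZmodType) : Type := G.

HB.instance Definition _ (G : topologicalZmodType) :=
  TopologicalZmodule.on (borel G).
HB.instance Definition _ (G : topologicalZmodType) :=
  isPointed.Build (borel G) (0 : G).
HB.instance Definition _ (G : topologicalZmodType) :=
  @isMeasurable.Build (sigma_display (@open G)) (borel G)
    <<s (@open G) >> (@sigma_algebra0 _ setT (@open G))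
    (@sigma_algebraC (borel G) (@open G))
    (@sigma_algebra_bigcup _ setT (@open G)).

Definition radon_measure (R : realType) (T : topologicalType)
    (mu : set T -> \bar R) :=
  [/\ forall K, compact K -> (mu K < +oo)%E,
      forall B, <<s (@open T) >> B ->
        mu B = ereal_inf [set mu U | U in [set U | open U /\ B `<=` U]]
    & forall U, open U ->
        mu U = ereal_sup [set mu K | K in [set K | compact K /\ K `<=` U]]].

Section group.
Context {R : realType} {G : topologicalZmodType}.

Definition translate (x : G) (A : set G) : set G := [set x + a | a in A].

Definition haar_measure (theta : {measure set (borel G) -> \bar R}) :=
  [/\ radon_measure (theta : set G -> \bar R),
      forall (x : G) (B : set (borel G)), measurable B ->
        theta (translate x B) = theta B
    & (0 < theta setT)%E].

Definition sum_set (A B : set G) : set G := [set a + b | a in A & b in B].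
Definition diff_set (A B : set G) : set G := [set a - b | a in A & b in B].

Definition vH_boundary (K A : set G) : set G :=
  (closure (sum_set A K) `&` closure (~` A)) `|`
  (closure (diff_set (~` A) K) `&` closure A).

Variable theta : {measure set (borel G) -> \bar R}.

Definition vol (A : set G) : R := fine (theta A).

Definition van_hove (A : (set G)^nat) :=
  [/\ forall n, open (A n) /\ precompact (A n),
      forall n, (0 < theta (A n))%E
    & forall K : set G, compact K ->
        (fun n => vol (vH_boundary K (A n)) / vol (A n)) @ \oo --> (0 : R)].

Definition cintegrable (D : set G) (f : G -> R[i]) :=
  theta.-integrable D (fun t : borel G => (complex.Re (f t))%:E) /\
  theta.-integrable D (fun t : borel G => (complex.Im (f t))%:E).

Definition cintegral (D : set G) (f : G -> R[i]) : R[i] :=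
  (\int[theta]_(t in D) complex.Re (f t)) +i*
  (\int[theta]_(t in D) complex.Im (f t)).

Definition cmeasurable (f : G -> R[i]) :=
  measurable_fun setT (fun t : borel G => complex.Re (f t)) /\
  measurable_fun setT (fun t : borel G => complex.Im (f t)).

Definition L2loc : set (G -> R[i]) :=
  [set f | cmeasurable f /\ forall K : set G, compact K ->
     (\int[theta]_(t in (K : set (borel G))) (normc (f t) ^+ 2)%:E < +oo)%E].

Definition average (A : set G) (f : G -> R[i]) : R[i] :=
  (vol A)^-1%:C * cintegral A f.

Definition is_refl_eberlein (A : (set G)^nat) (f h : G -> R[i]) :=
  forall t : G,
    (forall n, cintegrable (A n) (fun s => f s * (f (s - t))^* )) /\
    ((fun n => average (A n) (fun s => f s * (f (s - t))^* )) : nat -> R[i]^o)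
      @ \oo --> (h t : R[i]^o).

End group.

Arguments L2loc {R G} theta.

Section dual_group.
Variables (R : realType) (G : topologicalZmodType).

Definition characters : set {compact-open, G -> R[i]^o} :=
  [set chi | [/\ continuous (chi : G -> R[i]^o),
     forall x y : G, chi (x + y) = chi x * chi y &
     forall x : G, normc (chi x) = 1]].

(* The topology is the one induced by the compact-open topology. *)
Definition dual : Type := set_type characters.

HB.instance Definition _ := Topological.on dual.

Lemma trivial_characters : characters (fun=> 1).
Proof.
split=> [x|x y|x]; [exact: cvg_cst | by rewrite mulr1 | exact: Normc.normc1].
Qed.

Definition trivial_char : dual := SigSub (mem_set trivial_characters).

HB.instance Definition _ := isPointed.Build dual trivial_char.

Definition char_fun (chi : dual) : G -> R[i] := set_val chi.

Definition borel_dual := g_sigma_algebraType (@open dual).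

(* The measure sum_chi |a_chi|^2 delta_chi. *)
Definition point_mass_sum (a : dual -> R[i]) (B : set borel_dual) : \bar R :=
  (\esum_(chi in [set: dual])
    (normc (a chi) ^+ 2)%:E * \d_(chi : borel_dual) B)%E.

Section point_mass_sum_measure.
Local Open Scope ereal_scope.
Variable a : dual -> R[i].

Let delta_ge0 (chi : dual) (B : set borel_dual) :
  0 <= \d_(chi : borel_dual) B :> \bar R.
Proof. by have := measure_ge0 (dirac (R := R) (chi : borel_dual)) B; exact. Qed.

Let mass_ge0 (chi : dual) (B : set borel_dual) :
  0 <= (normc (a chi) ^+ 2)%:E * \d_(chi : borel_dual) B :> \bar R.
Proof.
apply: mule_ge0; first by rewrite lee_fin sqr_ge0.
exact: delta_ge0.
Qed.

Let pms0 : point_mass_sum a set0 = 0.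
Proof. by rewrite /point_mass_sum esum1 // => chi _; rewrite measure0 mule0. Qed.

Let pms_ge0 B : 0 <= point_mass_sum a B.
Proof. exact: esum_ge0. Qed.

Let pms_sigma_additive : semi_sigma_additive (point_mass_sum a).
Proof.
move=> F mF tF mUF.
have -> : point_mass_sum a (\bigcup_n F n) = \sum_(i <oo) point_mass_sum a (F i).
  rewrite nneseries_esumT //.
  have split_mass chi :
      (normc (a chi) ^+ 2)%:E * \d_(chi : borel_dual) (\bigcup_n F n) =
      \esum_(i in [set: nat]) (normc (a chi) ^+ 2)%:E * \d_(chi : borel_dual) (F i).
    rewrite -nneseries_esumT; last by move=> i; exact: mass_ge0.
    rewrite nneseriesZl; last by move=> i _; exact: delta_ge0.
    congr (_ * _); apply/esym/cvg_lim => //.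
    exact: measure_semi_sigma_additive.
  rewrite /point_mass_sum; under eq_esum do rewrite split_mass.
  rewrite !esum_esum //.
  rewrite (reindex_esum (setT `*`` (fun=> setT)) (setT `*`` (fun=> setT))
     (fun x : nat * dual => (x.2, x.1))) //.
  split=> [x //|[i x] [j y] _ _ [-> ->] //|[x i] _]; first by exists (i, x).
by apply: is_cvg_nneseries => n _ _; exact: pms_ge0.
Qed.

HB.instance Definition _ := isMeasure.Build _ borel_dual R (point_mass_sum a)
  pms0 pms_ge0 pms_sigma_additive.

End point_mass_sum_measure.
End dual_group.

Arguments char_fun {R G} chi.
Coercion char_fun : dual >-> Funclass.

Section harmonic_analysis.
Context {R : realType} {G : topologicalZmodType}.
Variable theta : {measure set (borel G) -> \bar R}.

Definition Cc : set (G -> R[i]) :=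
  [set phi | continuous (phi : G -> R[i]^o) /\
             compact (closure [set t | phi t != 0])].

Definition convolution (f g : G -> R[i]) (t : G) : R[i] :=
  cintegral theta setT (fun s => f s * g (t - s)).

Definition tilde (f : G -> R[i]) (s : G) : R[i] := (f (- s))^*.

(* Measures on G are taken as linear functionals on Cc; this is h theta_G. *)
Definition density_measure (h phi : G -> R[i]) : R[i] :=
  cintegral theta setT (fun t => phi t * h t).

Definition positive_definite (gamma : (G -> R[i]) -> R[i]) :=
  forall phi, Cc phi -> 0 <= gamma (convolution phi (tilde phi)).

Definition inverse_transform (phi : G -> R[i]) (chi : dual R G) : R[i] :=
  cintegral theta setT (fun t => chi t * phi t).

(* [0 <= z] in R[i] entails that z is real, so [complex.Re] loses nothing. *)
Definition is_fourier_transform (gamma : (G -> R[i]) -> R[i])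
    (nu : {measure set (borel_dual R G) -> \bar R}) :=
  [/\ positive_definite gamma,
      radon_measure (nu : set (dual R G) -> \bar R)
    & forall phi, Cc phi ->
        (\int[nu]_chi (normc (inverse_transform phi chi) ^+ 2)%:E)%E =
        (complex.Re (gamma (convolution phi (tilde phi))))%:E].

Definition weyl_norm (A : (set G)^nat) (f : G -> R[i]) : \bar R :=
  limn_esup (fun n =>
    ((ereal_sup [set ((vol theta (A n))^-1)%:E *
        \int[theta]_(t in (translate x (A n) : set (borel G)))
          (normc (f t) ^+ 2)%:E | x in [set: G]]) `^ 2^-1)%E).

Definition trig_poly : set (G -> R[i]) :=
  [set P | exists (m : nat) (a : 'I_m -> R[i]) (chi : 'I_m -> dual R G),
     P = (fun t => \sum_(i < m) a i * chi i t)].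

Definition weyl_almost_periodic (A : (set G)^nat) (f : G -> R[i]) :=
  L2loc theta f /\
  forall eps : R, 0 < eps -> exists2 P, trig_poly P &
    (weyl_norm A (fun t => f t - P t)%R < eps%:E)%E.

(* [a] is the Fourier-Bohr coefficient a_chi(f): the averages over s + A_n
   converge to [a] uniformly in s. *)
Definition is_fourier_bohr (A : (set G)^nat) (f : G -> R[i]) (chi : dual R G)
    (a : R[i]) :=
  forall eps : R, 0 < eps -> \forall n \near \oo, forall s : G,
    normc ((vol theta (A n))^-1%:C *
      cintegral theta (translate s (A n)) (fun t => (chi t)^* * f t) - a) < eps.

Definition linear_subspace (C : set (G -> R[i])) :=
  [/\ C (fun=> 0),
      forall f g, C f -> C g -> C (fun t => f t + g t)
    & forall (a : R[i]) f, C f -> C (fun t => a * f t)].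

Definition seminorm_on (C : set (G -> R[i])) (N : (G -> R[i]) -> R) :=
  [/\ forall f, C f -> 0 <= N f,
      forall f g, C f -> C g -> N (fun t => f t + g t) <= N f + N g
    & forall (a : R[i]) f, C f -> N (fun t => a * f t) = normc a * N f].

End harmonic_analysis.

(* Main.v *)
(* The value h_f(0) is the common limit of the mean squares of f along all van
   Hove sequences. Testing the Fourier transform of h_f theta_G against bump
   functions phi concentrating at 0 gives h_f(0) = sum |c_chi(f)|^2 = ||f||^2;
   the normalization int phi * phi~ = (int phi)^2 needs no Fubini, being the
   Fourier hypothesis for constant functions. Since translating the members of a
   van Hove sequence arbitrarily gives a van Hove sequence, the mean squares
   converge to ||f||^2 uniformly over translates, so ||f|| is the Weyl seminorm.
   Partial sums of the formal expansion then approximate f in that seminorm, and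
   polarizing with f + chi and f + i chi identifies c_chi(f) with the
   Fourier-Bohr coefficient. *)
Require Import Defs.
From HB Require Import structures.
From mathcomp Require Import all_boot all_order all_algebra.
From mathcomp Require Import all_classical all_reals all_analysis.
From mathcomp Require Import complex.
From mathcomp Require Import measurable_realfun ring lra.

Set Implicit Arguments.
Unset Strict Implicit.
Unset Printing Implicit Defensive.

Import Order.TTheory GRing.Theory Num.Theory.
Import numFieldNormedType.Exports.

Local Open Scope classical_set_scope.
Local Open Scope ring_scope.
Local Open Scope complex_scope.

(** * Moduli, real and imaginary parts, and their continuity *)

Section complex_numbers.
Context {R : realType}.
Implicit Types z w : R[i].

Lemma sqr_normcE z : normc z ^+ 2 = complex.Re z ^+ 2 + complex.Im z ^+ 2.
Proof. by case: z => a b; rewrite /normc /= sqr_sqrtr// addr_ge0 ?sqr_ge0. Qed.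

Lemma normc_ge0 z : 0 <= normc z.
Proof. by case: z => a b; exact: sqrtr_ge0. Qed.

Lemma normr_normc z : `|z| = (normc z)%:C.
Proof. by case: z. Qed.

Lemma normr_Re_le z : `|complex.Re z| <= normc z.
Proof. by have := normc_ge_Re z; rewrite normr_normc lecR. Qed.

Lemma normr_Im_le z : `|complex.Im z| <= normc z.
Proof.
rewrite -[leRHS]ger0_norm ?normc_ge0// -ler_sqr ?nnegrE// !real_normK ?num_real//.
by rewrite sqr_normcE lerDr sqr_ge0.
Qed.

Lemma normc_le_ReIm z : normc z <= `|complex.Re z| + `|complex.Im z|.
Proof.
rewrite -ler_sqr ?nnegrE ?addr_ge0 ?normc_ge0// sqr_normcE sqrrD !real_normK ?num_real//.
by rewrite -addrAC lerDl mulrn_wge0// mulr_ge0.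
Qed.

Lemma Re_subc z w : complex.Re (z - w) = complex.Re z - complex.Re w.
Proof. by case: z w => ? ? [? ?]. Qed.

Lemma Im_subc z w : complex.Im (z - w) = complex.Im z - complex.Im w.
Proof. by case: z w => ? ? [? ?]. Qed.

Lemma Re_mulc z w : complex.Re (z * w) =
  complex.Re z * complex.Re w - complex.Im z * complex.Im w.
Proof. by case: z w => ? ? [? ?]. Qed.

Lemma Im_mulc z w : complex.Im (z * w) =
  complex.Re z * complex.Im w + complex.Im z * complex.Re w.
Proof. by case: z w => ? ? [? ?]. Qed.

Lemma nbhs_normc_ball (z : R[i]^o) (e : R) : 0 < e ->
  \forall w \near z, normc (z - w : R[i]) < e.
Proof.
move=> e0; apply/nbhs_ballP; exists e%:C; first by rewrite /= ltcR.
by move=> w; rewrite /ball /= normr_normc ltcR.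
Qed.

Lemma Re_continuous : continuous (@complex.Re R : R[i]^o -> R).
Proof.
move=> z; apply/(@cvgrPdist_lt _ _ _ (nbhs (z : R[i]^o))) => e e0.
move: (nbhs_normc_ball z e0); apply: filterS => w; apply: le_lt_trans.
by rewrite -Re_subc; exact: normr_Re_le.
Qed.

Lemma Im_continuous : continuous (@complex.Im R : R[i]^o -> R).
Proof.
move=> z; apply/(@cvgrPdist_lt _ _ _ (nbhs (z : R[i]^o))) => e e0.
move: (nbhs_normc_ball z e0); apply: filterS => w; apply: le_lt_trans.
by rewrite -Im_subc; exact: normr_Im_le.
Qed.

Lemma real_complex_continuous : continuous (real_complex R : R -> R[i]^o).
Proof.
(* Positivity in [R[i]] forces the imaginary part [e'] of the radius to vanish. *)
move=> x U /nbhs_ballP[[e e']] /=; rewrite ltcE /= => /andP[/eqP e'0 e0] eU.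
have := @nbhsx_ballx R R x e e0.
apply: filterS => y; rewrite /ball /= => xy; apply: eU.
rewrite /ball /= e'0 -rmorphB normr_normc /=; rewrite ltcR /normc /=.
by rewrite expr0n addr0 sqrtr_sqr.
Qed.

End complex_numbers.

(** * Comparison of integrals without measurability *)

Section nonneg_integral.
Context d (T : measurableType d) (R : realType).
Variable mu : {measure set T -> \bar R}.
Local Open Scope ereal_scope.
Import HBNNSimple.

(* The integral of a nonnegative function is a supremum over simple functions
   below it, so measurability plays no role in these two comparisons. *)
Lemma ge0_le_integralT (f g : T -> \bar R) :
  (forall x, 0 <= f x) -> (forall x, f x <= g x) ->
  \int[mu]_x f x <= \int[mu]_x g x.
Proof.
move=> f0 fg; rewrite !ge0_integralTE//; last by move=> x; exact: le_trans (fg x).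
apply: ereal_sup_le => _ [h /= hf <-]; exists h => //= x.
exact: le_trans (hf x) (fg x).
Qed.

Lemma le_RintegralT (f g : T -> R) :
  (forall x, (0 <= g x)%R) -> (forall x, (f x <= g x)%R) ->
  \int[mu]_x (g x)%:E < +oo -> (\int[mu]_x f x <= \int[mu]_x g x)%R.
Proof.
move=> g0 fg goo; have fpg : \int[mu]_x (f x)%:E <= \int[mu]_x (g x)%:E.
  rewrite integralE (@le_trans _ _ (\int[mu]_x ((EFin \o f) ^\+ x)))//.
    by rewrite -[leRHS]sube0; apply: leeB => //; exact: integral_ge0.
  apply: ge0_le_integralT => // x; rewrite funeposE /=.
  by rewrite ge_max !lee_fin g0 fg.
have gfin : \int[mu]_x (g x)%:E \is a fin_num.
  by rewrite ge0_fin_numE// integral_ge0// => x _; rewrite lee_fin.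
(* The value [+oo] is excluded by the finite bound, and [fine] sends [-oo] to 0, which lies below
   the nonnegative right-hand side. *)
rewrite /Rintegral; move: fpg; case: (\int[mu]_x (f x)%:E) => [r| |].
- by move=> rg; rewrite fine_le.
- by rewrite leye_eq => /eqP E; rewrite E in gfin.
- by move=> _; apply: fine_ge0; apply: integral_ge0 => x _; rewrite lee_fin.
Qed.

End nonneg_integral.

(** * Linear operations on real integrable functions *)

Section real_integrable.
Context d (T : measurableType d) (R : realType).
Variable mu : {measure set T -> \bar R}.
Variables (D : set T) (mD : measurable D).
Implicit Types f g : T -> R.

Lemma Rintegral_eq0 f : (forall x, D x -> f x = 0) -> \int[mu]_(x in D) f x = 0.
Proof. by move=> f0; rewrite /Rintegral integral0_eq// => x /f0 ->. Qed.

Lemma integrable_EFinD f g :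
  mu.-integrable D (EFin \o f) -> mu.-integrable D (EFin \o g) ->
  mu.-integrable D (EFin \o (fun x => f x + g x)).
Proof. exact: integrableD. Qed.

Lemma integrable_EFinB f g :
  mu.-integrable D (EFin \o f) -> mu.-integrable D (EFin \o g) ->
  mu.-integrable D (EFin \o (fun x => f x - g x)).
Proof. exact: integrableB. Qed.

Lemma integrable_EFinZl k f :
  mu.-integrable D (EFin \o f) -> mu.-integrable D (EFin \o (fun x => k * f x)).
Proof. exact: integrableZl. Qed.

End real_integrable.

(** * Translates of sets, Borel measurability and van Hove sequences *)

Section topological_groups.
Context {R : realType} {G : topologicalZmodType}.
Implicit Types (x y : G) (A B K : set G).

Lemma translateE x A : translate x A = (fun y => y - x) @^-1` A.
Proof.
apply/seteqP; split => [_ [a Aa <-]|y Ay] /=; first by rewrite addrAC subrr add0r.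
by exists (y - x) => //; rewrite addrC subrK.
Qed.

Lemma translateK x A : translate (- x) (translate x A) = A.
Proof.
by rewrite !translateE; apply/funext => y /=; rewrite opprK addrK.
Qed.

Lemma addr_continuous x : continuous (fun y => y + x).
Proof.
move=> y; apply: (@continuous_comp _ _ _ (fun y => (y, x)) (fun z : G * G => z.1 + z.2)).
  by apply: cvg_pair => /=; [exact: cvg_id|exact: cvg_cst].
exact: add_continuous.
Qed.

Lemma open_translate x A : open A -> open (translate x A).
Proof.
by rewrite translateE; apply: open_comp => y _; exact: addr_continuous.
Qed.

Lemma closed_translate x A : closed A -> closed (translate x A).
Proof.
by rewrite translateE; apply: preimage_closed => y _; exact: addr_continuous.
Qed.

Lemma translateS x A B : A `<=` B -> translate x A `<=` translate x B.
Proof. exact: image_subset. Qed.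

Lemma closure_translate x A : closure (translate x A) = translate x (closure A).
Proof.
have sub y B : closure (translate y B) `<=` translate y (closure B).
  have /closure_id -> : closed (translate y (closure B)).
    by apply: closed_translate; exact: closed_closure.
  by apply: closureS; apply: translateS; exact: subset_closure.
apply/seteqP; split; first exact: sub.
(* The reverse inclusion is [sub] again, for the shift [- x] and the set [translate x A]. *)
rewrite -[X in translate x (closure X) `<=` _](translateK x A).
by move=> _ [a /sub + <-] => -[b ? <-]; rewrite addrA subrr add0r.
Qed.

Lemma translateC x A : ~` translate x A = translate x (~` A).
Proof. by rewrite !translateE. Qed.

Lemma translateI x A B :
  translate x (A `&` B) = translate x A `&` translate x B.
Proof. by rewrite !translateE. Qed.

Lemma translateU x A B :
  translate x (A `|` B) = translate x A `|` translate x B.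
Proof. by rewrite !translateE. Qed.

Lemma sum_set_translate x A K : sum_set (translate x A) K = translate x (sum_set A K).
Proof.
apply/seteqP; split => [_ [_ [a Aa <-] [k Kk <-]]|_ [_ [a Aa [k Kk <-]] <-]].
  by exists (a + k); [exists a => //; exists k|rewrite addrA].
by exists (x + a); [exists a|exists k => //; rewrite addrA].
Qed.

Lemma diff_set_translate x A K : diff_set (translate x A) K = translate x (diff_set A K).
Proof.
apply/seteqP; split => [_ [_ [a Aa <-] [k Kk <-]]|_ [_ [a Aa [k Kk <-]] <-]].
  by exists (a - k); [exists a => //; exists k|rewrite addrA].
by exists (x + a); [exists a|exists k => //; rewrite addrA].
Qed.

Lemma vH_boundary_translate x K A :
  vH_boundary K (translate x A) = translate x (vH_boundary K A).
Proof.
by rewrite /vH_boundary translateC sum_set_translate diff_set_translate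
  !closure_translate translateU !translateI.
Qed.

Lemma precompact_translate x A : precompact A -> precompact (translate x A).
Proof.
rewrite !precompactE closure_translate => cA; apply: continuous_compact => //.
apply: continuous_subspaceT => y.
have -> : +%R x = (fun y => y + x) by apply/funext => z; exact: addrC.
exact: addr_continuous.
Qed.

Lemma open_measurable_borel A : open A -> measurable (A : set (borel G)).
Proof. exact: sub_sigma_algebra. Qed.

Lemma closed_measurable_borel A : closed A -> measurable (A : set (borel G)).
Proof.
move=> cA; rewrite -(setCK A); apply: measurableC.
by apply: open_measurable_borel; exact: closed_openC.
Qed.

Lemma continuous_measurable_borel (f : G -> R) : continuous f ->
  measurable_fun setT (f : borel G -> R).
Proof.
move=> cf; apply: (measurability _ (RGenOpens.measurableE R)).
move=> _ [_ [a [b ->]] <-]; rewrite setTI; apply: open_measurable_borel.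
by apply: open_comp => [y _|]; [exact: cf|exact: interval_open].
Qed.

Context {theta : {measure set (borel G) -> \bar R}}.
Hypothesis haar_theta : haar_measure theta.

Lemma haar_translate x A : measurable (A : set (borel G)) ->
  theta (translate x A) = theta A.
Proof. by move=> mA; case: haar_theta => _ inv _; exact: inv. Qed.

Lemma vH_boundary_measurable K A : measurable (vH_boundary K A : set (borel G)).
Proof.
by apply: measurableU; apply: measurableI; apply: closed_measurable_borel;
  exact: closed_closure.
Qed.

(** Boundaries move along with their sets, so invariance of [theta] leaves every quotient of volumes
    unchanged, however the shifts vary with [n]. *)
Lemma van_hove_translate (A : (set G)^nat) (x : nat -> G) :
  van_hove theta A -> van_hove theta (fun n => translate (x n) (A n)).
Proof.
move=> [oA A0 vA]; have mA n : measurable (A n : set (borel G)).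
  by apply: open_measurable_borel; case: (oA n).
split=> [n|n|K /vA]; first by have [? ?] := oA n; split;
  [exact: open_translate|exact: precompact_translate].
- by rewrite haar_translate.
- apply: cvg_trans; apply: near_eq_cvg; near=> n.
  rewrite vH_boundary_translate /vol !haar_translate//.
  exact: vH_boundary_measurable.
Unshelve. all: by end_near. Qed.

Lemma precompact_lty A : precompact A -> measurable (A : set (borel G)) ->
  (theta A < +oo)%E.
Proof.
move=> pA mA; case: haar_theta => -[fin _ _] _ _.
rewrite precompactE in pA; apply: le_lt_trans (fin _ pA).
apply: le_measure; rewrite ?inE//; last exact: subset_closure.
by apply: closed_measurable_borel; exact: closed_closure.
Qed.

(** Precompactness enters because [fine] would turn an infinite measure into 0. *)
Lemma vol_gt0 (A : (set G)^nat) n : van_hove theta A -> 0 < vol theta (A n).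
Proof.
move=> [/(_ n)[oA pA] /(_ n) A0 _]; rewrite /vol fine_gt0// A0 /=.
by apply: precompact_lty => //; exact: open_measurable_borel.
Qed.

End topological_groups.

(** * Positivity of Haar measure on open sets, and continuous bumps at 0 *)

Section bump_functions.
Context {R : realType} {G : topologicalZmodType}.
Hypothesis hausdorffG : hausdorff_space G.
Hypothesis locally_compactG : locally_compact [set: G].
Context {theta : {measure set (borel G) -> \bar R}}.
Hypothesis haar_theta : haar_measure theta.

(** Finitely many translates of [U] cover any given compact set. If [U] were null, all compact sets
    would be null, and by inner regularity so would the whole group. *)
Lemma haar_open_gt0 (U : set G) : open U -> U 0 -> (0 < theta U)%E.
Proof.
move=> oU U0; rewrite lt0e measure_ge0 andbT; apply/eqP => U_null.
case: haar_theta => -[_ _ inner] _; rewrite (inner _ openT).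
move=> /ereal_sup_gt[_ [K [cK _] <-]]; apply/negP; rewrite -leNgt.
have := cK; rewrite (@compact_cover (borel G)).
move=> /(_ G setT (fun x => translate x U))[x _||D _ KD].
- exact: open_translate.
- by move=> y _; exists y => //; exists 0 => //; rewrite addr0.
have null (s : seq G) :
    measurable (\big[setU/set0]_(x <- s) translate x U : set (borel G)) /\
    theta (\big[setU/set0]_(x <- s) translate x U) = 0%E.
  elim/big_ind : _ => [|A B [mA A0] [mB B0]|x _].
  - by split => //; exact: measure0.
  - by split; [exact: measurableU|rewrite measureU0].
  - split; first by apply: open_measurable_borel; exact: open_translate.
    by rewrite (haar_translate haar_theta)//; exact: open_measurable_borel.
move: KD; rewrite /cover bigcup_fset => KD.
rewrite -(null (finmap.enum_fset D)).2.
apply: le_measure => //; rewrite inE//; last exact: (null _).1.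
apply: closed_measurable_borel.
exact: compact_closed.
Qed.

Lemma continuous_bounded_integrable (f : G -> R) (M : R) (K : set G) :
  continuous f -> compact K -> (forall t, ~ K t -> f t = 0) ->
  (forall t, `|f t| <= M) ->
  theta.-integrable setT (fun t : borel G => (f t)%:E).
Proof.
move=> cf cK f0 fM; have mK : measurable (K : set (borel G)).
  by apply: closed_measurable_borel; exact: compact_closed.
have -> : (fun t : borel G => (f t)%:E) = (fun t => (f t)%:E) \_ K.
  apply/funext => t; rewrite patchE; case: ifPn => //.
  by rewrite notin_setE => /f0 ->.
apply: ((integrable_mkcond (D := K : set (borel G)) _ _).1) => //.
apply: (@measurable_bounded_integrable _ (borel G) R theta f) => //.
- by case: haar_theta => -[fin _ _] _ _; exact: fin.
- by apply: measurable_funTS; exact: continuous_measurable_borel.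
- by exists M; split; [exact: num_real|move=> x Mx t _; exact: le_trans (ltW Mx)].
Qed.

(** Complete regularity separates 0 from the complement of [W], the interior of the intersection of
    [U] with a compact neighbourhood of 0. The separating function is 0 at 0 and 1 off [W], hence
    the reflection [1 - f]. *)
Lemma bump_function (U : set G) : nbhs 0 U -> exists phi : G -> R,
  [/\ continuous phi, forall t, 0 <= phi t <= 1, forall t, ~ U t -> phi t = 0,
      exists2 K, compact K & forall t, ~ K t -> phi t = 0 &
      0 < \int[theta]_t phi t].
Proof.
move=> nU; have [K nKT [cK clK]] : compact_near (within [set: G] (nbhs 0)).
  exact: locally_compactG.
have nK : nbhs 0 K by rewrite withinET in nKT.
pose W := (U `&` K)°.
have W0 : W 0 by apply: filterI.
have oW : open W by exact: open_interior.
have WUK : W `<=` U `&` K by exact: interior_subset.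
have := @locally_compact_completely_regular G R locally_compactG hausdorffG
  0 (~` W) (open_closedC oW) (fun h => h W0).
move=> /(@uniform_separatorP _ R)[f [cf f01 fW0 fW1]].
pose phi t := 1 - f t.
have phi01 t : 0 <= phi t <= 1.
  have /f01/= : range f (f t) by exists t.
  by rewrite in_itv /= /phi; lra.
have phi_out t : ~ W t -> phi t = 0.
  rewrite /phi => Wt; have /fW1 /= -> : (f @` (~` W)) (f t) by exists t.
  by rewrite subrr.
have phi0 : phi 0 = 1.
  by have /fW0 /= : (f @` [set 0]) (f 0) by [exists 0]; rewrite /phi => ->; rewrite subr0.
have cphi : continuous phi.
  by move=> t; apply: cvgB; [exact: cvg_cst|exact: cf].
have phiK t : ~ K t -> phi t = 0 by move=> Kt; apply: phi_out => /WUK[].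
exists phi; split => //; [by move=> t Ut; apply: phi_out => /WUK[]|by exists K|].
have iphi : theta.-integrable setT (fun t : borel G => (phi t)%:E).
  apply: (continuous_bounded_integrable cphi cK phiK (M := 1)) => t.
  by have /andP[? ?] := phi01 t; rewrite ger0_norm.
(* On the open neighbourhood [V] of 0, which has positive Haar measure, [phi] exceeds one half; this
   bounds its integral from below. *)
pose V := phi @^-1` [set x | x > 2^-1].
have oV : open V by apply: open_comp => [t _|]; [exact: cphi|exact: open_gt].
have mV := open_measurable_borel oV.
have V0 : (0 < theta V)%E.
  by apply: haar_open_gt0 => //; rewrite /V /= phi0; lra.
rewrite fine_gt0//; apply/andP; split; last first.
  have /integrable_fin_num := iphi; rewrite fin_numE => /(_ measurableT) /andP[_].
  by rewrite -ltey.
apply: (@lt_le_trans _ _ (\int[theta]_(t in V) (2^-1)%:E)%E).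
  by rewrite integral_cst// mule_gt0// lte_fin.
apply: (@le_trans _ _ (\int[theta]_(t in V) (phi t)%:E)%E); last first.
  apply: ge0_subset_integral => //; first exact: (measurable_int _ iphi).
  by move=> t _; rewrite lee_fin; case/andP: (phi01 t).
apply: ge0_le_integral => //.
- by apply: measurable_funTS; exact: (measurable_int _ iphi).
- by move=> t; rewrite /V /= lee_fin => /ltW.
Qed.

End bump_functions.

(** * Sums of point masses on the dual group *)

Section point_masses.
Context {R : realType} {G : topologicalZmodType}.
Variable a : dual R G -> R[i].
Local Open Scope ereal_scope.

Lemma point_mass_sumT :
  point_mass_sum a setT = \esum_(chi in [set: dual R G]) (normc (a chi) ^+ 2)%:E.
Proof. by apply: eq_esum => chi _; rewrite diracT mule1. Qed.

Lemma le_point_mass_sum (A : set (dual R G)) (W : set (borel_dual R G)) :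
  finite_set A -> A `<=` W ->
  \sum_(chi \in A) (normc (a chi) ^+ 2)%:E <= point_mass_sum a W.
Proof.
move=> finA AW; apply: esum_ge; exists A => //.
rewrite !fsbig_finite//= big_seq [leRHS]big_seq; apply: lee_sum => chi.
rewrite in_fset_set// inE => /AW Wchi.
by rewrite diracE mem_set// mule1.
Qed.

(** Points are compact, so evaluation at a point is continuous for the compact-open topology, and
    the set is an intersection of closed sets. This is what makes it Borel in
    [fourier_transform_ge]. *)
Lemma eval_closed (V : set G) (r : R) :
  closed [set chi : dual R G | forall t, V t -> (r <= complex.Re (chi t))%R].
Proof.
have -> : [set chi : dual R G | forall t, V t -> (r <= complex.Re (chi t))%R] =
    \bigcap_(t in V) [set chi : dual R G | (r <= complex.Re (chi t))%R].
  by [].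
apply: closed_bigI => t _; rewrite -[X in closed X]setCK; apply: open_closedC.
pose O := [set z : R[i]^o | (complex.Re z < r)%R].
have oO : open O.
  apply: (@open_comp _ _ (@complex.Re R : R[i]^o -> R) [set x | (x < r)%R]).
    by move=> z _; exact: Re_continuous.
  exact: open_lt.
pose E := [set g : {compact-open, G -> R[i]^o} | g @` [set t] `<=` O].
have oE : open E by apply: compact_open_open => //; exact: compact_set1.
have -> : ~` [set chi : dual R G | (r <= complex.Re (chi t))%R] =
    (set_val : dual R G -> {compact-open, G -> R[i]^o}) @^-1` E.
  apply/seteqP; split => chi /=.
    by move=> /negP; rewrite -ltNge => ? _ [_ -> <-].
  by move=> /(_ (chi t)) H; apply/negP; rewrite -ltNge; apply: H; exists t.
apply: open_comp => // chi _.
exact: (@initial_continuous _ _ (set_val : dual R G -> {compact-open, G -> R[i]^o})).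
Qed.

End point_masses.

(** * Bounds for the inverse transform of a bump *)

Section test_function.
Context {R : realType} {G : topologicalZmodType}.
Hypothesis hausdorffG : hausdorff_space G.
Context {theta : {measure set (borel G) -> \bar R}}.
Hypothesis haar_theta : haar_measure theta.
Variables (phi : G -> R) (K : set G).
Hypotheses (cphi : continuous phi) (phi01 : forall t, 0 <= phi t <= 1).
Hypotheses (cK : compact K) (phiK : forall t, ~ K t -> phi t = 0).

Let phiC (t : G) : R[i] := (phi t)%:C.
Let I0 : R := \int[theta]_t phi t.

Lemma Cc_test_function : Cc phiC.
Proof.
split.
  by move=> t; apply: continuous_comp; [exact: cphi|exact: real_complex_continuous].
apply: (@subclosed_compact _ _ K) => //; first exact: closed_closure.
rewrite [X in _ `<=` X](closure_id _).1; last exact: compact_closed.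
apply: closureS => t /=; apply: contra_neqP => Kt.
by rewrite /phiC phiK.
Qed.

Lemma char_Re_continuous (chi : dual R G) : continuous (fun t => complex.Re (chi t)).
Proof.
case: (set_mem (valP chi)) => cchi _ _ t.
by apply: (@continuous_comp G R[i]^o R chi (@complex.Re R)); [exact: cchi|exact: Re_continuous].
Qed.

Lemma char_Im_continuous (chi : dual R G) : continuous (fun t => complex.Im (chi t)).
Proof.
case: (set_mem (valP chi)) => cchi _ _ t.
by apply: (@continuous_comp G R[i]^o R chi (@complex.Im R)); [exact: cchi|exact: Im_continuous].
Qed.

Lemma normc_char (chi : dual R G) t : normc (chi t) = 1.
Proof. by case: (set_mem (valP chi)) => _ _; exact. Qed.

Lemma test_function_integrable (f : G -> R) : continuous f ->
  (forall t, `|f t| <= 1) ->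
  theta.-integrable setT (EFin \o (fun t : borel G => f t * phi t)).
Proof.
move=> cf f1.
apply: (@continuous_bounded_integrable R G hausdorffG theta haar_theta _ 1 K) => //.
- by move=> t; apply: continuousM; [exact: cf|exact: cphi].
- by move=> t /phiK ->; rewrite mulr0.
- move=> t; rewrite normrM; apply: mulr_ile1 => //.
  by have /andP[? ?] := phi01 t; rewrite ger0_norm.
Qed.

Lemma phi_integrable : theta.-integrable setT (EFin \o (phi : borel G -> R)).
Proof.
apply: (@continuous_bounded_integrable R G hausdorffG theta haar_theta _ 1 K) => // t.
by have /andP[? ?] := phi01 t; rewrite ger0_norm.
Qed.

Lemma inverse_transform_test (chi : dual R G) :
  inverse_transform theta phiC chi =
  (\int[theta]_t (complex.Re (chi t) * phi t)) +i*
  (\int[theta]_t (complex.Im (chi t) * phi t)).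
Proof.
rewrite /inverse_transform /cintegral; congr (_ +i* _); apply: eq_Rintegral => t _.
  by rewrite Re_mulc /= mulr0 subr0.
by rewrite Im_mulc /= mulr0 add0r.
Qed.

(* Rotating the transform onto the positive axis replaces [chi] by
   [u Re chi + v Im chi] with [u^2 + v^2 = r^2], which is at most [r]. *)
Lemma normc_inverse_transform_le (chi : dual R G) :
  normc (inverse_transform theta phiC chi) <= I0.
Proof.
rewrite inverse_transform_test.
set u := \int[theta]_t _; set v := \int[theta]_t _.
have iRe : theta.-integrable setT
    (EFin \o (fun t : borel G => complex.Re (chi t) * phi t)).
  apply: test_function_integrable => [|t]; first exact: char_Re_continuous.
  by rewrite -(normc_char chi t); exact: normr_Re_le.
have iIm : theta.-integrable setT
    (EFin \o (fun t : borel G => complex.Im (chi t) * phi t)).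
  apply: test_function_integrable => [|t]; first exact: char_Im_continuous.
  by rewrite -(normc_char chi t); exact: normr_Im_le.
set r := normc _; have r2 : r ^+ 2 = u ^+ 2 + v ^+ 2 by exact: sqr_normcE.
have r0 : 0 <= r by exact: normc_ge0.
have [-> |rneq0] := eqVneq r 0.
  by apply: Rintegral_ge0 => t _; case/andP: (phi01 t).
have rgt0 : 0 < r by rewrite lt_neqAle eq_sym rneq0.
rewrite -(ler_pM2l rgt0) -expr2 r2 /I0 -RintegralZl//; last exact: phi_integrable.
rewrite !expr2 {1}/u {1}/v -!RintegralZl// -RintegralD//; last first.
- exact: integrable_EFinZl.
- exact: integrable_EFinZl.
apply: le_Rintegral => //.
- by apply: integrable_EFinD => //; exact: integrable_EFinZl.
- exact: (integrable_EFinZl measurableT _ phi_integrable).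
- move=> t _; rewrite !mulrA -mulrDl ler_wpM2r//; first by case/andP: (phi01 t).
  have := sqr_normcE (chi t); rewrite normc_char expr1n.
  set x := complex.Re _; set y := complex.Im _ => xy1.
  apply: le_trans (ler_norm _) _; rewrite -ler_sqr ?nnegrE//.
  rewrite real_normK ?num_real// r2 -[leRHS]mulr1 xy1.
  (* Lagrange's identity, which yields the Cauchy-Schwarz bound on [u * x + v * y]. *)
  have -> : (u ^+ 2 + v ^+ 2) * (x ^+ 2 + y ^+ 2) =
    (u * x + v * y) ^+ 2 + (u * y - v * x) ^+ 2 by ring.
  by rewrite lerDl sqr_ge0.
Qed.

(** The modulus dominates the real part, which is the integral of [Re chi * phi]. This integrand is
    at least [r * phi], both sides being 0 where [phi] vanishes. *)
Lemma normc_inverse_transform_ge (chi : dual R G) (r : R) :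
  (forall t, phi t != 0 -> r <= complex.Re (chi t)) ->
  r * I0 <= normc (inverse_transform theta phiC chi).
Proof.
move=> rchi; apply: le_trans (normr_Re_le _); rewrite inverse_transform_test /=.
apply: le_trans (ler_norm _).
have iRe : theta.-integrable setT
    (EFin \o (fun t : borel G => complex.Re (chi t) * phi t)).
  apply: test_function_integrable => [|t]; first exact: char_Re_continuous.
  by rewrite -(normc_char chi t); exact: normr_Re_le.
rewrite /I0 -RintegralZl//; last exact: phi_integrable.
apply: le_Rintegral => //; first exact: (integrable_EFinZl measurableT _ phi_integrable).
move=> t _; have [->|/rchi rt] := eqVneq (phi t) 0; first by rewrite !mulr0.
by rewrite ler_wpM2r//; case/andP: (phi01 t).
Qed.

End test_function.

(** * Testing a Fourier transform against the autocorrelation of a bump *)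

Section autocorrelation.
Context {R : realType} {G : topologicalZmodType}.
Hypothesis hausdorffG : hausdorff_space G.
Context {theta : {measure set (borel G) -> \bar R}}.
Hypothesis haar_theta : haar_measure theta.
Variables (phi : G -> R) (K : set G).
Hypotheses (cphi : continuous phi) (phi01 : forall t, 0 <= phi t <= 1).
Hypotheses (cK : compact K) (phiK : forall t, ~ K t -> phi t = 0).

Let phiC (t : G) : R[i] := (phi t)%:C.
Let I0 : R := \int[theta]_t phi t.

(** This is the convolution of [phi] with [tilde phi], kept real-valued: for real [phi], [tilde phi]
    at [t - s] is [phi (s - t)]. *)
Definition autocorrelation (t : G) : R := \int[theta]_s (phi s * phi (s - t)).

Lemma autocorrelation_ge0 t : 0 <= autocorrelation t.
Proof.
apply: Rintegral_ge0 => s _.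
by apply: mulr_ge0; [case/andP: (phi01 s)|case/andP: (phi01 (s - t))].
Qed.

Lemma autocorrelation_out (V : set G) t : (forall s, phi s != 0 -> V s) ->
  ~ diff_set V V t -> autocorrelation t = 0.
Proof.
move=> phiV Vt; apply: Rintegral_eq0 => s _; apply/eqP; rewrite mulf_eq0; apply: contra_notT Vt.
rewrite negb_or => /andP[/phiV Vs /phiV Vst]; exists s => //; exists (s - t) => //.
by rewrite opprB addrC subrK.
Qed.

Lemma density_autocorrelation (h : G -> R[i]) :
  complex.Re (density_measure theta h (convolution theta phiC (tilde phiC))) =
  \int[theta]_t (autocorrelation t * complex.Re (h t)).
Proof.
have autoE t : convolution theta phiC (tilde phiC) t = (autocorrelation t)%:C.
  rewrite /convolution /cintegral /tilde /phiC; congr (_ +i* _).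
    apply: eq_Rintegral => s _.
    by rewrite Re_mulc /= mul0r subr0 opprB.
  apply: Rintegral_eq0 => s _.
  by rewrite Im_mulc /= oppr0 mulr0 mul0r addr0.
apply: eq_Rintegral => t _; rewrite autoE Re_mulc /=.
by rewrite mul0r subr0.
Qed.

Variables (h : G -> R[i]) (a : dual R G -> R[i]).
Hypothesis ha : is_fourier_transform theta (density_measure theta h) (point_mass_sum a).

(** The left side is the integral of the squared modulus of the inverse transform of [phi], which is
    at most [I0 ^+ 2], against a measure of total mass [E]. *)
Lemma fourier_transform_le (E : R) : point_mass_sum a setT = E%:E ->
  \int[theta]_t (autocorrelation t * complex.Re (h t)) <= E * I0 ^+ 2.
Proof.
move=> aE; have [_ _ /(_ phiC)] := ha.
move=> /(_ (Cc_test_function hausdorffG cphi cK phiK)).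
rewrite density_autocorrelation => nuE; rewrite -lee_fin -nuE.
have -> : (E * I0 ^+ 2)%:E = (\int[point_mass_sum a]_chi (I0 ^+ 2)%:E)%E.
  by rewrite integral_cst//= aE -EFinM mulrC.
apply: ge0_le_integralT => chi; rewrite lee_fin ?sqr_ge0//.
rewrite ler_sqr ?nnegrE ?normc_ge0//.
  exact: (normc_inverse_transform_le hausdorffG haar_theta cphi phi01 cK phiK).
by apply: Rintegral_ge0 => t _; case/andP: (phi01 t).
Qed.

(** Only the mass on the closed set [W] of characters with real part at least [r] on the support of
    [phi] is kept. There the inverse transform has modulus at least [r * I0], and [W] contains
    [A]. *)
Lemma fourier_transform_ge (A : set (dual R G)) (r : R) :
  finite_set A -> 0 <= r ->
  (forall chi, A chi -> forall t, phi t != 0 -> r <= complex.Re (chi t)) ->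
  (((r * I0) ^+ 2)%:E * \sum_(chi \in A) (normc (a chi) ^+ 2)%:E <=
   (\int[theta]_t (autocorrelation t * complex.Re (h t)))%:E)%E.
Proof.
move=> finA r0 Ar; have [_ _ /(_ phiC)] := ha.
move=> /(_ (Cc_test_function hausdorffG cphi cK phiK)).
rewrite density_autocorrelation => <-.
pose W : set (borel_dual R G) :=
  [set chi : dual R G | forall t, phi t != 0 -> r <= complex.Re (chi t)].
have mW : measurable W.
  rewrite -(setCK W); apply: measurableC; apply: sub_sigma_algebra.
  by apply: closed_openC; exact: eval_closed.
have I0_ge0 : 0 <= I0 by apply: Rintegral_ge0 => t _; case/andP: (phi01 t).
apply: (@le_trans _ _ (\int[point_mass_sum a]_chi
   (((r * I0) ^+ 2)%:E * (\1_W chi)%:E))%E).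
  rewrite ge0_integralZl_EFin ?sqr_ge0//; last first.
    by apply/measurable_EFinP; exact: measurable_indic.
  rewrite integral_indic// setIT lee_wpmul2l ?lee_fin ?sqr_ge0//.
  exact: le_point_mass_sum.
apply: ge0_le_integralT => chi; first by rewrite mule_ge0// lee_fin ?sqr_ge0.
rewrite -EFinM lee_fin indicE; case: (boolP (chi \in W)) => [|_]; last first.
  by rewrite mulr0 sqr_ge0.
rewrite inE /= mulr1 => Wchi; rewrite ler_sqr ?nnegrE ?normc_ge0 ?mulr_ge0//.
exact: (normc_inverse_transform_ge hausdorffG haar_theta cphi phi01 cK phiK).
Qed.

End autocorrelation.

(** * Identification of the value at 0 with the total mass *)

Section mean_square.
Context {R : realType} {G : topologicalZmodType}.
Hypothesis hausdorffG : hausdorff_space G.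
Hypothesis locally_compactG : locally_compact [set: G].
Context {theta : {measure set (borel G) -> \bar R}}.
Hypothesis haar_theta : haar_measure theta.

Let triv : dual R G := trivial_char R G.

(** A constant [b] has a single mass [b] at the trivial character; the square root compensates the
    squared moduli in [point_mass_sum]. *)
Hypothesis fourier_cst : forall b : R, 0 < b ->
  is_fourier_transform theta (density_measure theta (fun=> b%:C))
    (point_mass_sum (fun chi => (Num.sqrt b)%:C * (chi == triv)%:R)).

Lemma near_diff_set (U : set G) : nbhs 0 U ->
  exists2 V, nbhs (0 : G) V & diff_set V V `<=` U.
Proof.
move=> nU; have : nbhs (0 - 0 : G) U by rewrite subr0.
move=> /(@sub_continuous G (0, 0))[[A B] [/= nA nB] AB].
exists (A `&` B); first exact: filterI.
by move=> _ [x [Ax _] [y [_ By] <-]]; exact: (AB (x, y)).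
Qed.

(** At 0 a character is idempotent and of modulus 1, hence equal to 1. Continuity settles one
    character, and finitely many neighbourhoods of 0 are then intersected. *)
Lemma near_finite_chars (A : set (dual R G)) (e : R) : finite_set A -> 0 < e ->
  \forall t \near (0 : G), forall chi, A chi -> 1 - e <= complex.Re (chi t).
Proof.
move=> finA e0.
have near1 (chi : dual R G) : \forall t \near (0 : G), 1 - e <= complex.Re (chi t).
  have chi0 : complex.Re (chi 0) = 1.
    case: (set_mem (valP chi)) => _ chiD _.
    have chi0_neq0 : chi 0 != 0.
      apply/eqP => chi0; have := normc_char chi 0.
      by rewrite chi0 /normc Normc.normc0 => /esym/eqP; rewrite oner_eq0.
    have /(mulfI chi0_neq0) : chi 0 * chi 0 = chi 0 * 1 by rewrite -chiD addr0 mulr1.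
    by move=> ->.
  have : complex.Re (chi t) @[t --> (0 : G)] --> complex.Re (chi 0).
    exact: char_Re_continuous.
  move=> /cvgrPdist_le /(_ e e0).
  apply: filterS => t; rewrite chi0 => /ler_normlP[_]; lra.
have near_seq (s : seq (dual R G)) :
    \forall t \near (0 : G), forall chi : dual R G, chi \in s -> 1 - e <= complex.Re (chi t).
  elim: s => [|chi s IH]; first exact: nearW.
  apply: filterS2 (near1 chi) IH => t chit st psi; rewrite inE.
  by move=> /predU1P[->|/st].
apply: filterS (near_seq (finmap.enum_fset (fset_set A))) => t At chi Achi.
by apply: At; rewrite in_fset_set// inE.
Qed.

Lemma esum_delta (psi : dual R G) (z : R[i]) :
  \esum_(chi in [set: dual R G]) (normc (z * (chi == psi)%:R) ^+ 2)%:E =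
  (normc z ^+ 2)%:E.
Proof.
rewrite -(@esum_set1 _ _ psi (fun=> (normc z ^+ 2)%:E)) ?lee_fin ?sqr_ge0//.
rewrite [RHS]esum_mkcond; apply: eq_esum => chi _.
have -> : (chi \in [set psi]) = (chi == psi) by apply/idP/eqP; rewrite inE.
case: eqP => _; first by rewrite mulr1.
by rewrite mulr0 /normc Normc.normc0 expr0n.
Qed.

(** The bump is supported where the characters in [A] have real part at least [1 - e], and
    differences of points of its support lie where [Re h] is within [e] of [Re (h 0)]. Testing with
    its autocorrelation [g] and dividing by [I0 ^+ 2] gives both bounds. *)
Lemma mean_square_bounds (h : G -> R[i]) (a : dual R G -> R[i]) (E e : R)
    (A : set (dual R G)) :
  continuous (h : G -> R[i]^o) ->
  is_fourier_transform theta (density_measure theta h) (point_mass_sum a) ->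
  point_mass_sum a setT = E%:E -> 0 <= complex.Re (h 0) ->
  0 < e -> e < 1 -> finite_set A ->
  (((1 - e) ^+ 2)%:E * \sum_(chi \in A) (normc (a chi) ^+ 2)%:E <=
    (complex.Re (h 0) + e)%:E)%E /\
  (e < complex.Re (h 0) -> complex.Re (h 0) - e <= E).
Proof.
move=> ch ha aE h0 e0 e1 finA; set m := complex.Re (h 0).
have nU : \forall t \near (0 : G), `|m - complex.Re (h t)| <= e.
  have : complex.Re (h t) @[t --> (0 : G)] --> m.
    by apply: (@continuous_comp G R[i]^o R h (@complex.Re R)); [exact: ch|exact: Re_continuous].
  by move=> /cvgrPdist_le /(_ e e0).
have [V nV VU] := near_diff_set nU.
have [phi [cphi phi01 phiV [K cK phiK]]] := bump_function hausdorffG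
  locally_compactG haar_theta (filterI nV (near_finite_chars finA e0)).
set I0 := \int[theta]_t _ => I0_gt0.
have phi_supp t : phi t != 0 -> V t /\ forall chi, A chi -> 1 - e <= complex.Re (chi t).
  by apply: contraNP => /phiV ->; rewrite eqxx.
pose g := @autocorrelation R G theta phi.
have g0 t : 0 <= g t by exact: autocorrelation_ge0.
(* Off [diff_set V V] the autocorrelation is 0; on it [Re h] is within [e] of [m]. *)
have hg t : g t * (m - e) <= g t * complex.Re (h t) <= g t * (m + e).
  have [/VU|Vt] := pselect (diff_set V V t); last first.
    by rewrite /g (autocorrelation_out (V := V)) ?mul0r ?lexx// => s /phi_supp[].
  by rewrite /= => /ler_normlP[mh1 mh2]; apply/andP; split; apply: ler_wpM2l => //; lra.
have I02 : 0 < I0 ^+ 2 by rewrite exprn_gt0.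
have cst_mass b : 0 < b ->
    point_mass_sum (fun chi => (Num.sqrt b)%:C * (chi == triv)%:R) setT = b%:E.
  move=> b0; rewrite point_mass_sumT esum_delta sqr_normcE /= expr0n addr0.
  by rewrite sqr_sqrtr// ltW.
(* Together with [cst_ge], this evaluates the integral of [g * b] as [b * I0 ^+ 2]; the only mass
   sits at [triv], whose value is 1 everywhere. *)
have cst_le b : 0 < b -> \int[theta]_t (g t * b) <= b * I0 ^+ 2.
  move=> b0; exact: (fourier_transform_le hausdorffG haar_theta cphi phi01 cK phiK
    (fourier_cst b0) (cst_mass b b0)).
have cst_ge b : 0 < b -> b * I0 ^+ 2 <= \int[theta]_t (g t * b).
  move=> b0; have := @fourier_transform_ge _ _ hausdorffG _ haar_theta _ _ cphi
    phi01 cK phiK _ _ (fourier_cst b0) [set triv] 1 (finite_set1 _) ler01.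
  rewrite fsbig_set1 eqxx mulr1 sqr_normcE /= expr0n addr0 sqr_sqrtr; last exact: ltW.
  rewrite mul1r -EFinM lee_fin mulrC; apply => _ -> t _.
  by rewrite /triv /char_fun /=.
(* A positive real integral excludes the value [+oo], which [fine] would turn into 0. *)
have cst_fin b : 0 < b -> (\int[theta]_t (g t * b)%:E < +oo)%E.
  move=> b0; have : 0 < \int[theta]_t (g t * b).
    by apply: lt_le_trans (cst_ge b b0); rewrite mulr_gt0.
  by rewrite /Rintegral; case: (integral _ _ _) => [r _|/=|_]; rewrite ?ltry ?ltxx.
have me0 : 0 < m + e by rewrite ltr_wpDl.
split.
  have Ar chi : A chi -> forall t, phi t != 0 -> 1 - e <= complex.Re (chi t).
    by move=> Achi t /phi_supp[_]; exact.
  have := fourier_transform_ge hausdorffG haar_theta cphi phi01 cK phiK ha finA _ Ar.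
  rewrite subr_ge0 (ltW e1) => /(_ isT) ge_A.
  have le_me : \int[theta]_t (g t * complex.Re (h t)) <= (m + e) * I0 ^+ 2.
    apply: le_trans (cst_le _ me0); apply: le_RintegralT => [t|t|].
    - by rewrite mulr_ge0// ltW.
    - by case/andP: (hg t).
    - exact: cst_fin.
  rewrite -(@lee_pmul2r _ (I0 ^+ 2)%:E) ?lte_fin// -EFinM.
  rewrite muleAC -EFinM -exprMn; apply: le_trans ge_A _.
  by rewrite lee_fin.
(* The assumption [e < m] makes [m - e] a positive constant, as [fourier_cst] demands. *)
move=> em; have me1 : 0 < m - e by rewrite subr_gt0.
rewrite -(ler_pM2r I02); apply: le_trans (cst_ge _ me1) _.
apply: le_trans (fourier_transform_le hausdorffG haar_theta cphi phi01 cK phiK ha aE).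
have gh0 t : 0 <= g t * complex.Re (h t).
  by case/andP: (hg t) => + _; apply: le_trans; rewrite mulr_ge0// ltW.
apply: le_RintegralT => // [t|]; first by case/andP: (hg t).
(* Finiteness comes from the majorant [g * (m + e)]. *)
apply: le_lt_trans (cst_fin _ me0); apply: ge0_le_integralT => t; rewrite lee_fin//.
by case/andP: (hg t).
Qed.

(** Each strict inequality is refuted by [mean_square_bounds] with a tolerance [e] small against the
    gap between the two numbers. *)
Lemma mean_square_fourier (h : G -> R[i]) (a : dual R G -> R[i]) (E : R) :
  continuous (h : G -> R[i]^o) ->
  is_fourier_transform theta (density_measure theta h) (point_mass_sum a) ->
  point_mass_sum a setT = E%:E -> 0 <= complex.Re (h 0) ->
  complex.Re (h 0) = E.
Proof.
move=> ch ha aE h0; set m := complex.Re (h 0).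
have bounds e A := @mean_square_bounds h a E e A ch ha aE h0.
have E0 : 0 <= E by rewrite -lee_fin -aE; exact: measure_ge0.
apply/eqP; rewrite eq_le; apply/andP; split.
  rewrite leNgt; apply/negP => Em.
  (* As [E] is nonnegative, this [e] is below [m], and [m - e <= E] would bound the gap [m - E] by
     its own half. *)
  pose e := Num.min (2^-1) ((m - E) / 2).
  have e0 : 0 < e by rewrite lt_min; apply/andP; split; lra.
  have [e1 e2] : e <= 2^-1 /\ e <= (m - E) / 2 by rewrite !ge_min !lexx orbT.
  have [||_ /(_ _)] := bounds e set0 e0; [lra|exact: finite_set0|].
  have em : e < m by lra.
  by move=> /(_ em); rewrite -/m; lra.
rewrite leNgt; apply/negP => mE.
(* For a finite [A] carrying more than [E - e] of the mass, the first bound gives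
   [(1 - e)^2 (E - e) <= m + e]. The left side is at least [E - e - 2 e E], so
   [E - m <= 2 e (1 + E)], which is at most half of [E - m]. *)
pose e := Num.min (2^-1) ((E - m) / (4 * (1 + E))).
have E1 : 0 < 4 * (1 + E) by lra.
have e0 : 0 < e by rewrite lt_min; apply/andP; split; [lra|rewrite divr_gt0//; lra].
have [e1 e2] : e <= 2^-1 /\ e <= (E - m) / (4 * (1 + E)).
  by rewrite !ge_min !lexx orbT.
rewrite ler_pdivlMr// in e2.
have : ((E - e)%:E < point_mass_sum a setT)%E by rewrite aE lte_fin; lra.
rewrite point_mass_sumT => /ereal_sup_gt[_ [A [finA _] <-] EA].
have [||+ _] := bounds e A e0; [lra|by []|].
move=> /(le_trans _) H; have : ((((1 - e) ^+ 2)%:E * (E - e)%:E) <= (m + e)%:E)%E.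
  by apply: H; rewrite lee_wpmul2l ?lee_fin ?sqr_ge0// ltW.
rewrite -EFinM lee_fin; nra.
Qed.

End mean_square.

(** * Mean squares and the Weyl seminorm on [C] *)

Section parseval_space.
Context {R : realType} {G : topologicalZmodType}.
Hypothesis hausdorffG : hausdorff_space G.
Hypothesis locally_compactG : locally_compact [set: G].
Context {theta : {measure set (borel G) -> \bar R}}.
Hypothesis haar_theta : haar_measure theta.
Variable C : set (G -> R[i]).
Hypothesis C_L2loc : C `<=` L2loc theta.
Hypothesis C_linear : linear_subspace C.
Variable N : (G -> R[i]) -> R.
Hypothesis N_seminorm : seminorm_on C N.
Variable c : (G -> R[i]) -> dual R G -> R[i].
Hypothesis parseval : forall f, C f ->
  (N f ^+ 2)%:E = \esum_(chi in [set: dual R G]) (normc (c f chi) ^+ 2)%:E.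
Hypothesis chars_C : forall chi : dual R G, C chi.
Hypothesis coef_char : forall chi psi : dual R G, c chi psi = (psi == chi)%:R.
Hypothesis coefD : forall f g, C f -> C g ->
  forall chi, c (fun t => f t + g t) chi = c f chi + c g chi.
Hypothesis coefZ : forall (a : R[i]) f, C f ->
  forall chi, c (fun t => a * f t) chi = a * c f chi.
Hypothesis eberlein : forall f, C f -> exists h : G -> R[i],
  [/\ continuous (h : G -> R[i]^o),
      forall A, van_hove theta A -> is_refl_eberlein theta A f h
    & is_fourier_transform theta (density_measure theta h)
        (point_mass_sum (c f))].
Variable A : (set G)^nat.
Hypothesis vhA : van_hove theta A.

Let triv : dual R G := trivial_char R G.

Lemma van_hove_measurable B n : van_hove theta B -> measurable (B n : set (borel G)).
Proof. by move=> [oB _ _]; apply: open_measurable_borel; case: (oB n). Qed.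

Lemma mulc_conj (z : R[i]) : z * z^* = (normc z ^+ 2)%:C.
Proof.
rewrite sqr_normcE; case: z => x y; apply/eqP; rewrite eq_complex /=.
by rewrite !expr2; apply/andP; split; apply/eqP; ring.
Qed.

Lemma average_cst B n (b : R) : van_hove theta B ->
  average theta (B n) (fun=> b%:C) = b%:C.
Proof.
move=> vB; have mB := van_hove_measurable n vB.
rewrite /average /cintegral /= !Rintegral_cst// mul0r -/(vol theta (B n)).
rewrite -[_ +i* 0]/((b * vol theta (B n))%:C) -rmorphM mulrCA mulVf ?mulr1//.
by rewrite gt_eqF// (vol_gt0 haar_theta n vB).
Qed.

(** The function [sqrt b * triv] lies in [C], and its reflected Eberlein convolution along [A]
    averages the constant [b]. By uniqueness of limits [h] is that constant, and the masses are read
    off the coefficients. *)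
Lemma fourier_cst (b : R) : 0 < b ->
  is_fourier_transform theta (density_measure theta (fun=> b%:C))
    (point_mass_sum (fun chi => (Num.sqrt b)%:C * (chi == triv)%:R)).
Proof.
move=> b0; have [_ _ CZ] := C_linear.
have [h [_ hE]] := eberlein (CZ (Num.sqrt b)%:C _ (chars_C triv)).
have triv1 s : triv s = 1 by [].
have -> : (fun=> b%:C) = h.
  apply/funext => t; have [_ ht] := hE _ vhA t.
  move: ht; rewrite (_ : (fun n => _) = fun=> b%:C); last first.
    apply/funext => n; rewrite -[RHS](average_cst n b vhA).
    congr (average _ _ _); apply/funext => s.
    by rewrite !triv1 mulr1 mulc_conj sqr_normcE /= expr0n addr0 sqr_sqrtr// ltW.
  apply: (@cvg_unique R[i]^o (@norm_hausdorff _ R[i]^o)).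
  exact: (cvg_cst (b%:C : R[i]^o)).
rewrite (_ : (fun chi => _) = c (fun t => (Num.sqrt b)%:C * triv t))//.
by apply/funext => chi; rewrite coefZ// coef_char.
Qed.

(** At [t = 0] the reflected Eberlein convolution averages the squared modulus of [f]; by Parseval
    the total mass of its transform is [N f ^+ 2]. *)
Lemma mean_square_cvg f B : C f -> van_hove theta B ->
  (forall n, theta.-integrable (B n) (EFin \o (fun t : borel G => normc (f t) ^+ 2))) /\
  (vol theta (B n))^-1 * (\int[theta]_(t in B n) normc (f t) ^+ 2) @[n --> \oo] -->
    N f ^+ 2.
Proof.
move=> Cf vB; have [h [ch hE hF]] := eberlein Cf.
have fE : (fun s => f s * (f (s - 0))^*) = (fun s => (normc (f s) ^+ 2)%:C).
  by apply/funext => s; rewrite subr0 mulc_conj.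
have [iB hB] := hE _ vB 0; rewrite fE in iB hB; split; first by move=> n; case: (iB n).
pose u n := (vol theta (B n))^-1 * (\int[theta]_(t in B n) normc (f t) ^+ 2).
have uh : u n @[n --> \oo] --> complex.Re (h 0).
  rewrite (_ : u = fun n => complex.Re (average theta (B n) (fun s => (normc (f s) ^+ 2)%:C))).
    exact: (@continuous_cvg _ R[i]^o R _ _ _ (@complex.Re R) _ (@Re_continuous R (h 0)) hB).
  by apply/funext => n; rewrite /average Re_mulc /= mul0r subr0.
suff <- : complex.Re (h 0) = N f ^+ 2 by [].
apply: (mean_square_fourier hausdorffG locally_compactG haar_theta fourier_cst ch hF).
  by rewrite point_mass_sumT parseval.
(* [Re (h 0)] is nonnegative as a limit of nonnegative averages. *)
rewrite -(cvg_lim _ uh)//; apply: limr_ge; first by apply/cvg_ex; exists (complex.Re (h 0)).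
apply: nearW => n; apply: mulr_ge0.
  by rewrite invr_ge0 fine_ge0.
by apply: Rintegral_ge0 => t _; rewrite sqr_ge0.
Qed.

Let msq f n s :=
  (vol theta (A n))^-1 * (\int[theta]_(t in translate s (A n)) normc (f t) ^+ 2).

Lemma vol_translate n s : vol theta (translate s (A n)) = vol theta (A n).
Proof.
by rewrite /vol (haar_translate haar_theta)//; exact: van_hove_measurable.
Qed.

Lemma mean_square_integrable f n s : C f ->
  theta.-integrable (translate s (A n)) (EFin \o (fun t : borel G => normc (f t) ^+ 2)).
Proof.
move=> Cf.
by have [+ _] := mean_square_cvg Cf (van_hove_translate haar_theta (fun=> s) vhA); exact.
Qed.

(* A sequence of bad translates [s_n + A_n] would again be a van Hove sequence. *)
Lemma mean_square_uniform f (e : R) : C f -> 0 < e ->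
  \forall n \near \oo, forall s, `|N f ^+ 2 - msq f n s| < e.
Proof.
move=> Cf e0; pose bad n := [set s | e <= `|N f ^+ 2 - msq f n s|].
(* [xget] picks a bad shift whenever one exists and 0 otherwise, so convergence along these shifts
   rules out bad ones for large [n]. *)
pose x n := xget 0 (bad n).
have [_] := mean_square_cvg Cf (van_hove_translate haar_theta x vhA).
move=> /cvgrPdist_lt /(_ e e0); apply: filterS => n /=.
rewrite vol_translate => good s; rewrite ltNge; apply/negP => bads.
by have := xgetPex 0 (ex_intro (bad n) s bads); rewrite /bad /= leNgt => /negP.
Qed.

(** Uniformity in the shift squeezes the suprema [W n] to [N f ^+ 2]. The upper limit is therefore a
    limit, through which the square root passes. *)
Lemma weyl_normE f : C f -> weyl_norm theta A f = (N f)%:E.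
Proof.
move=> Cf.
pose W n := ereal_sup [set (((vol theta (A n))^-1)%:E *
  \int[theta]_(t in (translate x (A n) : set (borel G))) (normc (f t) ^+ 2)%:E)%E
  | x in [set: G]].
have msqE n s : (((vol theta (A n))^-1)%:E *
    \int[theta]_(t in (translate s (A n) : set (borel G))) (normc (f t) ^+ 2)%:E)%E =
    (msq f n s)%:E.
  rewrite /msq EFinM; congr (_ * _)%E; rewrite fineK//.
  apply: integrable_fin_num; last exact: mean_square_integrable.
  by apply: open_measurable_borel; apply: open_translate; case: vhA => /(_ n)[].
have W_bounds e : 0 < e -> \forall n \near \oo,
    ((N f ^+ 2 - e)%:E <= W n <= (N f ^+ 2 + e)%:E)%E.
  move=> e0; apply: filterS (mean_square_uniform Cf e0) => n Hn.
  apply/andP; split.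
    apply: (@le_trans _ _ (msq f n 0)%:E).
      by move: (Hn 0); rewrite ltr_distl lee_fin => /andP[? ?]; lra.
    by apply: ereal_sup_ubound; exists 0 => //; rewrite msqE.
  apply: ge_ereal_sup => _ [s _ <-]; rewrite msqE lee_fin.
  by move: (Hn s); rewrite ltr_distl => /andP[? ?]; lra.
have W_ge0 n : (0 <= W n)%E.
  apply: (@le_trans _ _ (msq f n 0)%:E); last first.
    by apply: ereal_sup_ubound; exists 0 => //; rewrite msqE.
  rewrite lee_fin mulr_ge0//; first by rewrite invr_ge0 fine_ge0.
  by apply: Rintegral_ge0 => t _; exact: sqr_ge0.
have W_fin : \forall n \near \oo, W n \is a fin_num.
  apply: filterS (W_bounds 1 ltr01) => n /andP[_ W1].
  by rewrite ge0_fin_numE//; apply: le_lt_trans W1 (ltry _).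
have W_cvg : fine (W n) @[n --> \oo] --> N f ^+ 2.
  apply/cvgrPdist_le => e e0; apply: filterS2 W_fin (W_bounds e e0) => n Wn.
  by rewrite -(fineK Wn) !lee_fin => /andP[? ?]; rewrite ler_distl; lra.
have N0 : 0 <= N f by case: N_seminorm => + _ _; apply.
have root_cvg : (W n `^ 2^-1)%E @[n --> \oo] --> (N f)%:E.
  have : (Num.sqrt (fine (W n)))%:E @[n --> \oo] --> (N f)%:E.
    apply: cvg_EFin; first exact: nearW.
    rewrite -[N f]ger0_norm// -sqrtr_sqr.
    exact: (continuous_cvg _ (@sqrt_continuous R (N f ^+ 2)) W_cvg).
  apply: cvg_trans; apply: near_eq_cvg; apply: filterS W_fin => n Wn /=.
  by rewrite -{2}(fineK Wn) poweR_EFin powR12_sqrt// fine_ge0.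
rewrite -[RHS](cvg_lim _ root_cvg)//; apply: is_cvg_limn_esupE.
by apply/cvg_ex; exists (N f)%:E.
Qed.

(** * Approximation by partial sums of the formal expansion *)

Lemma esum_shift (d : dual R G -> R[i]) (chi : dual R G) (z : R[i]) (E1 E2 : R) :
  E1%:E = \esum_(psi in [set: dual R G]) (normc (d psi) ^+ 2)%:E ->
  E2%:E = \esum_(psi in [set: dual R G]) (normc (d psi + z * (psi == chi)%:R) ^+ 2)%:E ->
  E2 = E1 + normc (d chi + z) ^+ 2 - normc (d chi) ^+ 2.
Proof.
rewrite (esumID [set chi])//; last by move=> psi _; rewrite lee_fin sqr_ge0.
rewrite [in X in _ -> X](esumID [set chi])//; last first.
  by move=> psi _; rewrite lee_fin sqr_ge0.
rewrite !setTI !esum_set1 ?lee_fin ?sqr_ge0//.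
rewrite eqxx mulr1.
have -> : \esum_(psi in ~` [set chi]) (normc (d psi + z * (psi == chi)%:R) ^+ 2)%:E =
    \esum_(psi in ~` [set chi]) (normc (d psi) ^+ 2)%:E.
  by apply: eq_esum => psi /= /eqP/negPf ->; rewrite mulr0 addr0.
(* The common sum over the other characters is finite because the total [E1] is, so it cancels. *)
case: (esum _ _) => [t| |] // [->] [->]; ring.
Qed.

(** Adding [z * chi] alters only the coefficient at [chi]. This serves both to remove terms of the
    expansion and to polarize. *)
Lemma seminorm_add_char f (chi : dual R G) (z : R[i]) : C f ->
  C (fun t => f t + z * chi t) /\
  N (fun t => f t + z * chi t) ^+ 2 =
    N f ^+ 2 + normc (c f chi + z) ^+ 2 - normc (c f chi) ^+ 2.
Proof.
move=> Cf; have [_ CD CZ] := C_linear; have Cz := CZ z _ (chars_C chi).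
split; first exact: CD.
apply: esum_shift; first exact: parseval.
rewrite parseval; last exact: CD.
by apply: eq_esum => psi _; rewrite coefD// coefZ// coef_char.
Qed.

Lemma coef_add_chars f (b : dual R G -> R[i]) (s : seq (dual R G)) : C f ->
  C (fun t => f t + \sum_(chi <- s) b chi * char_fun chi t) /\
  forall psi, c (fun t => f t + \sum_(chi <- s) b chi * char_fun chi t) psi =
    c f psi + \sum_(chi <- s) b chi * (psi == chi)%:R.
Proof.
move=> Cf; have [_ CD CZ] := C_linear.
elim: s => [|chi s [Cs cs]].
  have -> : (fun t => f t + \sum_(chi <- [::]) b chi * char_fun chi t) = f.
    by apply/funext => t; rewrite big_nil addr0.
  by split => // psi; rewrite big_nil addr0.
have -> : (fun t => f t + \sum_(chi <- chi :: s) b chi * char_fun chi t) =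
    (fun t => (f t + \sum_(chi <- s) b chi * char_fun chi t) + b chi * chi t).
  by apply/funext => t; rewrite big_cons addrCA addrC.
have Cb := CZ (b chi) _ (chars_C chi).
split=> [|psi]; first exact: CD.
by rewrite coefD// cs coefZ// coef_char big_cons [RHS]addrCA [RHS]addrC.
Qed.

(** The equality behind Bessel's inequality: since [s] has no repetition, the coefficient at [chi]
    is still [c f chi] when its term is subtracted, and becomes 0. *)
Lemma seminorm_sub_chars f (s : seq (dual R G)) : C f -> uniq s ->
  N (fun t => f t + \sum_(chi <- s) - c f chi * char_fun chi t) ^+ 2 =
  N f ^+ 2 - \sum_(chi <- s) normc (c f chi) ^+ 2.
Proof.
move=> Cf; elim: s => [_|chi s IH /= /andP[chis us]].
  rewrite big_nil subr0; congr (N _ ^+ 2).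
  by apply/funext => t; rewrite big_nil addr0.
have [Cs cs] := coef_add_chars (fun chi => - c f chi) s Cf.
have [_] := seminorm_add_char chi (- c f chi) Cs.
have -> : c (fun t => f t + \sum_(psi <- s) - c f psi * char_fun psi t) chi = c f chi.
  rewrite cs big_seq big1 ?addr0// => psi psis.
  case: (eqVneq chi psi) => [chipsi|_]; last by rewrite mulr0.
  by rewrite chipsi psis in chis.
rewrite IH//.
rewrite subrr /normc Normc.normc0 expr0n addr0 big_cons opprD addrA addrAC => <-.
congr (N _ ^+ 2); apply/funext => t.
by rewrite big_cons addrCA addrC.
Qed.

(** By Parseval, finitely many characters carry more than [N f ^+ 2 - e ^+ 2]; [P] is the partial
    sum of the expansion over them. *)
Lemma trig_poly_approx f (e : R) : C f -> 0 < e -> exists2 P,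
  trig_poly P & C (fun t => f t - P t) /\ N (fun t => f t - P t) < e.
Proof.
move=> Cf e0.
have : ((N f ^+ 2 - e ^+ 2)%:E < (N f ^+ 2)%:E)%E.
  by rewrite lte_fin ltrBlDr ltrDl exprn_gt0.
rewrite parseval// => /ereal_sup_gt[_ [B [finB _] <-]].
rewrite fsbig_finite//; set s := finmap.enum_fset _ => sB.
have us : uniq s by exact: finmap.fset_uniq.
have [Cs _] := coef_add_chars (fun chi => - c f chi) s Cf.
have Ns := seminorm_sub_chars Cf us.
pose P t := \sum_(chi <- s) c f chi * char_fun chi t.
have fP : (fun t => f t - P t) =
    (fun t => f t + \sum_(chi <- s) - c f chi * char_fun chi t).
  apply/funext => t; rewrite /P -sumrN; congr (_ + _).
  by apply: eq_bigr => chi _; rewrite mulNr.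
exists P.
  exists (size s), (fun i => c f (nth triv s i)), (fun i => nth triv s i).
  by apply/funext => t; rewrite /P (big_nth triv) big_mkord.
rewrite fP; split => //.
have N0 : 0 <= N (fun t => f t + \sum_(chi <- s) - c f chi * char_fun chi t).
  by case: N_seminorm => + _ _; apply.
rewrite -ltr_sqr ?nnegrE//; last exact: ltW.
rewrite Ns; move: sB; rewrite sumEFin lte_fin; lra.
Qed.

Lemma mem_weyl_almost_periodic f : C f -> weyl_almost_periodic theta A f.
Proof.
move=> Cf; split => [|e e0]; first exact: C_L2loc.
have [P tP [CfP NfP]] := trig_poly_approx Cf e0.
by exists P => //; rewrite weyl_normE// lte_fin.
Qed.

(** * Fourier-Bohr coefficients by polarization *)

Lemma normc_sqr_add (z w : R[i]) : normc (z + w) ^+ 2 =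
  normc z ^+ 2 + 2 * complex.Re (w^* * z) + normc w ^+ 2.
Proof. by rewrite !sqr_normcE; case: z w => x y [u v] /=; ring. Qed.

(* Polarization: the inner products of [f] with [chi] are differences of the
   mean squares of [f + z chi] and [f], both members of [C]. *)
Lemma polarized_average f (chi : dual R G) (z : R[i]) (e : R) :
  C f -> normc z = 1 -> 0 < e -> \forall n \near \oo, forall s,
  theta.-integrable (translate s (A n))
    (EFin \o (fun t : borel G => complex.Re (z^* * ((chi t)^* * f t)))) /\
  `|(vol theta (A n))^-1 *
     (\int[theta]_(t in translate s (A n)) complex.Re (z^* * ((chi t)^* * f t))) -
     complex.Re (z^* * c f chi)| < e.
Proof.
move=> Cf z1 e0; have [Cfz Nfz] := seminorm_add_char chi z Cf.
apply: filterS2 (mean_square_uniform Cf e0) (mean_square_uniform Cfz e0).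
move=> n f_near fz_near s; move: (f_near s) (fz_near s).
have mD : measurable (translate s (A n) : set (borel G)).
  by apply: open_measurable_borel; apply: open_translate; case: vhA => /(_ n)[].
have if_ := mean_square_integrable n s Cf.
have ifz := mean_square_integrable n s Cfz.
(* The constant 1 is the squared modulus of [chi], a member of [C]. *)
have i1 : theta.-integrable (translate s (A n)) (EFin \o (fun _ : borel G => 1)).
  have := mean_square_integrable n s (chars_C chi).
  by under [X in _.-integrable _ (EFin \o X)]eq_fun do rewrite normc_char expr1n.
have polE : (fun t : borel G => complex.Re (z^* * ((chi t)^* * f t))) = (fun t =>
    2^-1 * (normc (f t + z * chi t) ^+ 2 - normc (f t) ^+ 2 - 1)).
  apply/funext => t; rewrite normc_sqr_add rmorphM mulrA /normc Normc.normcM.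
  by rewrite -!/(normc _) z1 normc_char !mul1r expr1n; field.
have ifzf := integrable_EFinB mD ifz if_.
have ifzf1 := integrable_EFinB mD ifzf i1.
rewrite polE RintegralZl// RintegralB// RintegralB// Rintegral_cst// mul1r.
rewrite -/(vol theta _) vol_translate /msq Nfz normc_sqr_add z1 expr1n.
have v0 := vol_gt0 haar_theta n vhA; set v := vol theta (A n) in v0 *.
set X := \int[theta]_(t in _) _; set Y := \int[theta]_(t in _) _.
set r := complex.Re _.
(* The error is half the difference of the mean square errors of [f] and [f + z * chi], each below
   [e]. *)
have -> : v^-1 * (2^-1 * (Y - X - v)) - r = 2^-1 *
  ((N f ^+ 2 - v^-1 * X) - (N f ^+ 2 + (normc (c f chi) ^+ 2 + 2 * r + 1) -
     normc (c f chi) ^+ 2 - v^-1 * Y)).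
  by field; rewrite gt_eqF.
move=> /ltr_normlP[? ?] /ltr_normlP[? ?]; split; first exact: integrable_EFinZl.
by apply/ltr_normlP; split; lra.
Qed.

(** Polarizing with [z = 1] controls the real part and with [z = 'i] the imaginary part, each within
    [e / 2] uniformly in the shift. *)
Lemma mem_fourier_bohr f (chi : dual R G) : C f ->
  is_fourier_bohr theta A f chi (c f chi).
Proof.
move=> Cf e e0; have e2 : 0 < e / 2 by rewrite divr_gt0.
have norm1 : normc (1 : R[i]) = 1 by exact: Normc.normc1.
have normi : normc ('i : R[i]) = 1.
  by rewrite /normc /= expr0n expr1n add0r sqrtr1.
apply: filterS2 (polarized_average chi Cf norm1 e2) (polarized_average chi Cf normi e2).
move=> n Re_near Im_near s; have [_ Re_s] := Re_near s; have [_ Im_s] := Im_near s.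
have Re1 w : complex.Re ((1 : R[i])^* * w) = complex.Re w.
  by case: w => x y /=; ring.
have Rei w : complex.Re (('i : R[i])^* * w) = complex.Im w.
  by case: w => x y /=; ring.
move: Re_s Im_s; rewrite Re1 Rei; under eq_Rintegral do rewrite Re1.
under [in X in _ -> X -> _]eq_Rintegral do rewrite Rei; move=> Re_s Im_s.
apply: le_lt_trans (normc_le_ReIm _) _; rewrite [e]splitr; apply: ltrD.
  by rewrite Re_subc Re_mulc /= mul0r subr0.
by rewrite Im_subc Im_mulc /= mul0r addr0.
Qed.

End parseval_space.

Theorem lemma6p2 (R : realType) (G : topologicalZmodType)
    (hausdorffG : hausdorff_space G)
    (locally_compactG : locally_compact [set: G])
    (sigma_compactG : sigma_compact G)
    (theta : {measure set (borel G) -> \bar R})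
    (haar_theta : haar_measure theta)
    (C : set (G -> R[i])) (C_L2loc : C `<=` L2loc theta)
    (C_linear : linear_subspace C)
    (N : (G -> R[i]) -> R) (N_seminorm : seminorm_on C N)
    (* c f chi is the coefficient c_chi(f) *)
    (c : (G -> R[i]) -> dual R G -> R[i])
    (parseval : forall f, C f ->
       (N f ^+ 2)%:E = \esum_(chi in [set: dual R G]) (normc (c f chi) ^+ 2)%:E)
    (chars_C : forall chi : dual R G, C chi)
    (coef_char : forall chi psi : dual R G, c chi psi = (psi == chi)%:R)
    (coefD : forall f g, C f -> C g ->
       forall chi, c (fun t => f t + g t) chi = c f chi + c g chi)
    (coefZ : forall (a : R[i]) f, C f ->
       forall chi, c (fun t => a * f t) chi = a * c f chi)
    (eberlein : forall f, C f -> exists h : G -> R[i],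
       [/\ continuous (h : G -> R[i]^o),
           forall A, van_hove theta A -> is_refl_eberlein theta A f h
         & is_fourier_transform theta (density_measure theta h)
             (point_mass_sum (c f))]) :
  forall A : (set G)^nat, van_hove theta A ->
  forall f, C f ->
    [/\ weyl_almost_periodic theta A f,
        (N f)%:E = weyl_norm theta A f
      & forall chi : dual R G, is_fourier_bohr theta A f chi (c f chi)].
Proof.
move=> A vhA f Cf; split.
- exact: (mem_weyl_almost_periodic hausdorffG locally_compactG haar_theta
    C_L2loc C_linear N_seminorm parseval chars_C coef_char coefD coefZ eberlein vhA Cf).
- exact/esym/(weyl_normE hausdorffG locally_compactG haar_theta
    C_linear N_seminorm parseval chars_C coef_char coefZ eberlein vhA Cf).
- move=> chi; exact: (mem_fourier_bohr hausdorffG locally_compactG haar_theta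
    C_linear parseval chars_C coef_char coefD coefZ eberlein vhA chi Cf).
Qed.
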